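(* Let $J$ be a finite set with $m:=|J|\ge2$ and let $\mathcal{Z}=(J,h,\boldsymbol g)$ be a uniform polymatroid with increment sequence $\boldsymbol g=(g_i)_{0\le i\le m}$ such that $g_0\ge g_1>g_2=0$. Then for every partition $\Pi=(P_x)_{x\in J}$ of a finite set $P$ of participants with $g_0<|P_x|$ for all $x\in J$, and every monotone increasing family $\Delta\subseteq\mathcal{P}(J)\setminus\{\emptyset\}$ compatible with $\mathcal{Z}$, the access structure $\Gamma(\Pi,\mathcal{Z},\Delta)$ is ideal.
   Context: Polymatroids. For a finite set $J$ let $\mathcal{P}(J)$ be its power set. An (integer) polymatroid is a pair $(J,h)$ with $h:\mathcal{P}(J)\to\mathbb{N}_0$ such that $h(\emptyset)=0$, $h(X)\le h(Y)$ if $X\subseteq Y$, and $h(X\cap Y)+h(X\cup Y)\le h(X)+h(Y)$. It is uniform if $h(X)=h(Y)$ whenever $|X|=|Y|$; write $h_i=h(X)$ for $|X|=i$. With $m=|J|$, its increment sequence is $\boldsymbol g=(g_0,\dots,g_m)$, $g_i=h_{i+1}-h_i$ for $0\le i\le m-1$ and $g_m=0$; it is a nonincreasing sequence of nonnegative integers, and $g_0>0$ is assumed. Such a polymatroid is written $\mathcal{Z}=(J,h,\boldsymbol g)$. Compatibility. A monotone increasing family $\Delta\subseteq\mathcal{P}(J)\setminus\{\emptyset\}$ is a nonempty family of nonempty subsets of $J$ closed under taking supersets in $J$. Fix $x_0\notin J$ and define $h'$ on $\mathcal{P}(J\cup\{x_0\})$ by $h'(X)=h(X)$ for $X\subseteq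 J$, $h'(X\cup\{x_0\})=h(X)$ if $X\in\Delta$, and $h'(X\cup\{x_0\})=h(X)+1$ if $X\subseteq J$, $X\notin\Delta$. $\Delta$ is compatible with $\mathcal{Z}$ if $h'$ is monotone increasing and submodular. Access structure. A partition $\Pi=(P_x)_{x\in J}$ of $P$ consists of pairwise disjoint nonempty sets (blocks) with union $P$. For $A\subseteq P$ put $\pi(A)=(|A\cap P_x|)_{x\in J}\in\mathbb{N}_0^J$. For $\bar v\in\mathbb{N}_0^J$ and $Y\subseteq J$ put $\mathrm{supp}(\bar v)=\{x:v_x\ne0\}$, $|\bar v|=\sum_{x\in J}v_x$, $|\bar v_Y|=\sum_{x\in Y}v_x$. For $X\subseteq J$ let $\mathcal{B}(\mathcal{Z},X)=\{\bar v\in\mathbb{N}_0^J:\mathrm{supp}(\bar v)\subseteq X,\ |\bar v|=h(X),\ |\bar v_Y|\le h(Y)\text{ for all }Y\subseteq X\}$. Then $\Gamma(\Pi,\mathcal{Z},\Delta)$ is the family of all $A\subseteq P$ such that $\pi(A)\ge\bar v$ (coordinatewise) for some $\bar v\in\bigcup_{X\in\Delta}\mathcal{B}(\mathcal{Z},X)$. Ideal access structures. A perfect secret sharing scheme with access structure $\Gamma\subseteq\mathcal{P}(P)$ consists of jointly distributed random variables $s_0$ (the secret) and $s_p$, $p\in P$ (the shares), with values in finite sets $S_0$ (with $|S_0|\ge2$) and $S_p$ respectively, every element of these sets being taken with positive probability, such that for $A\in\Gamma$ the shares $(s_p)_{p\in A}$ determine the secret $s_0$, and for $A\subseteq P$,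 $A\notin\Gamma$, the tuple $(s_p)_{p\in A}$ is independent of $s_0$ (reveals no information about the secret). The scheme is ideal if $|S_p|=|S_0|$ for all $p\in P$. The access structure $\Gamma$ is ideal if it is the access structure of some ideal perfect secret sharing scheme. *)

(* Defs.v *)
From HB Require Import structures.
From mathcomp Require Import all_boot all_order all_algebra.
From mathcomp Require Import reals.

Set Implicit Arguments.
Unset Strict Implicit.
Unset Printing Implicit Defensive.

Import Order.TTheory GRing.Theory Num.Theory.

Section SetFunctions.
Variable J : finType.
Implicit Types (h : {set J} -> nat) (X Y : {set J}).

Definition set_monotone h : Prop := forall X Y, X \subset Y -> h X <= h Y.

Definition set_submodular h : Prop :=
  forall X Y, h (X :&: Y) + h (X :|: Y) <= h X + h Y.

Definition polymatroid h : Prop :=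
  [/\ h set0 = 0, set_monotone h & set_submodular h].

Definition uniform h : Prop := forall X Y, #|X| = #|Y| -> h X = h Y.

(* For a uniform polymatroid, [h Y - h X] is h_(i+1) - h_i with i = #|X|; the
   subtraction never truncates, by monotonicity.  The sequence has indices
   0, ..., #|J|; the values of [g] beyond #|J| are irrelevant. *)
Definition increment_sequence h (g : nat -> nat) : Prop :=
  (forall X Y, #|Y| = #|X|.+1 -> g #|X| = h Y - h X) /\ g #|J| = 0.

Definition uniform_polymatroid h (g : nat -> nat) : Prop :=
  [/\ polymatroid h, uniform h, increment_sequence h g & 0 < g 0].

Definition monotone_family (Delta : {set {set J}}) : Prop :=
  [/\ Delta != set0, set0 \notin Delta
    & forall X Y, X \in Delta -> X \subset Y -> Y \in Delta].

(* The extended ground set J + {x0} is [option J], with x0 = [None]. *)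
Definition extension h (Delta : {set {set J}}) (X : {set option J}) : nat :=
  let X' := [set x | Some x \in X] in
  if (None \in X) && (X' \notin Delta) then (h X').+1 else h X'.

End SetFunctions.

Definition compatible (J : finType) (h : {set J} -> nat)
    (Delta : {set {set J}}) : Prop :=
  set_monotone (extension h Delta) /\ set_submodular (extension h Delta).

Section AccessStructure.
Variables (J P : finType).
Implicit Types (v : {ffun J -> nat}) (X Y : {set J}) (A : {set P}).

(* [P] is the whole set of participants; block [x] is [Pi x]. *)
Definition participant_partition (Pi : J -> {set P}) : Prop :=
  [/\ forall x, Pi x != set0,
      forall x y, x != y -> [disjoint Pi x & Pi y]
    & \bigcup_x Pi x = [set: P]].

Definition block_counts (Pi : J -> {set P}) A : {ffun J -> nat} :=
  [ffun x => #|A :&: Pi x|].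

Definition supp v : {set J} := [set x | v x != 0].

Definition weight v Y : nat := \sum_(x in Y) v x.

Definition basis_vector (h : {set J} -> nat) X v : Prop :=
  [/\ supp v \subset X, weight v [set: J] = h X
    & forall Y, Y \subset X -> weight v Y <= h Y].

Definition access_structure (Pi : J -> {set P}) (h : {set J} -> nat)
    (Delta : {set {set J}}) : {set P} -> Prop :=
  fun A => exists X v,
    [/\ X \in Delta, basis_vector h X v & forall x, v x <= block_counts Pi A x].

End AccessStructure.

Local Open Scope ring_scope.

Section FiniteProbability.
Variables (R : realType) (Omega : finType) (mu : Omega -> R).

Definition is_distribution : Prop :=
  (forall w, 0 <= mu w) /\ \sum_w mu w = 1.

Definition prob (E : {set Omega}) : R := \sum_(w in E) mu w.

Definition full_range (U : finType) (X : Omega -> U) : Prop :=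
  forall a, 0 < prob [set w | X w == a].

Definition determines (U V : finType) (X : Omega -> U) (Y : Omega -> V) : Prop :=
  exists f : U -> V, prob [set w | Y w == f (X w)] = 1.

Definition independent (U V : finType) (X : Omega -> U) (Y : Omega -> V) : Prop :=
  forall a b, prob [set w | (X w == a) && (Y w == b)] =
              prob [set w | X w == a] * prob [set w | Y w == b].

End FiniteProbability.

Section SecretSharing.
Variables (R : realType) (P : finType).

Definition share_tuple (S : P -> finType) (A : {set P}) : finType :=
  {dffun forall p : {p : P | p \in A}, S (val p)}.

Definition joint_share (Omega : finType) (S : P -> finType)
    (s : forall p, Omega -> S p) (A : {set P}) (w : Omega) : share_tuple S A :=
  [ffun p : {p : P | p \in A} => s (val p) w].

(* Finitely many random variables with finite ranges are always realised, with
   the same joint law, on a finite probability space [(Omega, mu)]. *)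
Record perfect_scheme (Gamma : {set P} -> Prop) := PerfectScheme {
  sample : finType;
  mass : sample -> R;
  secret_set : finType;
  share_set : P -> finType;
  secret : sample -> secret_set;
  share : forall p, sample -> share_set p;
  mass_distribution : is_distribution mass;
  secret_set_gt1 : (2 <= #|secret_set|)%N;
  secret_range : full_range mass secret;
  share_range : forall p, full_range mass (share p);
  correctness : forall A, Gamma A -> determines mass (joint_share share A) secret;
  privacy : forall A, ~ Gamma A -> independent mass (joint_share share A) secret
}.

Definition ideal_scheme (Gamma : {set P} -> Prop) (Sigma : perfect_scheme Gamma)
    : Prop :=
  forall p, #|share_set Sigma p| = #|secret_set Sigma|.

Definition ideal_access_structure (Gamma : {set P} -> Prop) : Prop :=
  exists Sigma : perfect_scheme Gamma, ideal_scheme Sigma.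

End SecretSharing.

(* Main.v *)
Require Import Defs.
From mathcomp Require Import all_boot all_order all_algebra all_field.
From mathcomp Require Import reals.

(* Put a = g 0, b = g 1, so that h has value a on singletons and a + b on larger
   sets.  A set A with block counts u_x is authorized iff u_x >= a for some x
   with {x} in Delta, or \sum_x min(u_x, a) >= a + b.  Over a large finite field
   K, take a nonzero vector w0 of K^(a+b) and subspaces V_x of dimension a, any
   two of which span K^(a+b), such that w0 lies in V_x exactly when {x} is in
   Delta; compatibility gives a > b when Delta has two singletons, and this is
   what makes room for such V_x.  Choosing w_p generically in V_x for p in block
   x, the vector w0 is in the span of (w_p), p in A, iff A is authorized.  With f
   a uniformly random linear form, the secret f(w0) and the shares f(w_p) form
   an ideal scheme. *)

Set Implicit Arguments.
Unset Strict Implicit.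
Unset Printing Implicit Defensive.

Import Order.TTheory GRing.Theory Num.Theory.

(** * Avoiding finitely many proper subspaces over a large finite field *)

Lemma exists_notin_subspaces (K : finFieldType) (n : nat) (I : finType)
    (V : {vspace 'rV[K]_n}) (U : I -> {vspace 'rV[K]_n}) :
  #|I| < #|K| -> (forall i, ~~ (V <= U i)%VS) ->
  exists2 v, v \in V & forall i, v \notin U i.
Proof.
move=> ltIK nsubVU.
case: (pickP [pred v | (v \in V) && [forall i, v \notin U i]]) => [v | noV].
  by case/andP=> Vv /forallP Uv; exists v.
case/idP: (ltnn #|V|).
have K_gt0 : 0 < #|K| by rewrite (leq_ltn_trans _ ltIK).
(* Even the vector 0 has to be covered, so [I] is inhabited; through [i0] this yields [0 < \dim V],
   which makes [(\dim V).-1] a true predecessor. *)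
have [i0 _] : exists i0 : I, true.
  have := noV 0%R; rewrite /= mem0v /= => /forallPn [i _]; by exists i.
have le_dim i : \dim (V :&: U i) < \dim V.
  have sVU := capvSl V (U i).
  rewrite (ltn_leqif (dimv_leqif_sup sVU)).
  by apply: contra (nsubVU i) => /subv_trans-> //; exact: capvSr.
have Vgt0 : 0 < \dim V by apply: leq_trans (le_dim i0).
have le_cover : #|V| <= \sum_i #|(V :&: U i)%VS|.
  have sub : [set v in V] \subset \bigcup_i [set v in (V :&: U i)%VS].
    apply/subsetP=> v; rewrite inE => Vv; have := noV v.
    rewrite /= Vv /= => /forallPn [i]; rewrite negbK => Uv.
    by apply/bigcupP; exists i; rewrite // inE memv_cap Vv.
  rewrite -cardsE (leq_trans (subset_leq_card sub)) //.
  elim/big_rec2: _ => [|i m A _ leAm]; first by rewrite cards0.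
  rewrite (leq_trans (leq_card_setU _ _)) // leq_add //.
  by rewrite cardsE.
(* Each [V :&: U i] is proper in [V], hence has at most [#|K| ^ (\dim V).-1] elements; fewer than
   [#|K|] such subspaces cannot cover [V]. *)
apply: leq_ltn_trans le_cover _.
apply: (@leq_ltn_trans (#|I| * #|K| ^ (\dim V).-1)).
  rewrite -sum_nat_const leq_sum // => i _.
  by rewrite card_vspace leq_pexp2l // -ltnS prednK.
by rewrite card_vspace -{2}(prednK Vgt0) expnS ltn_pmul2r // expn_gt0 K_gt0.
Qed.

Lemma dimv_add_line (K : fieldType) (L : vectType K) (U : {vspace L}) (v : L) :
  v \notin U -> \dim (U + <[v]>) = (\dim U).+1.
Proof.
move=> Uv; have v0 : v != 0%R by apply: contraNneq Uv => ->; rewrite mem0v.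
rewrite dimv_disjoint_sum ?dim_vline ?v0 ?addn1 //.
apply/eqP; rewrite -subv0; apply/subvP=> u; rewrite memv_cap => /andP[Uu].
case/vlineP=> k uE; rewrite memv0 uE; move: Uu; rewrite uE.
have [-> | k0] := eqVneq k 0%R; first by rewrite scale0r.
by rewrite rpredZeq (negPf k0) (negPf Uv).
Qed.

(** * Vectors in general position inside prescribed subspaces *)

Section GenericFamilies.

Variables (K : finFieldType) (n : nat) (Q : finType).
Notation L := 'rV[K]_n.
Implicit Types (w : Q -> L) (B C : {set Q}).

Definition span_of w B : {vspace L} := (\sum_(q in B) <[w q]>)%VS.

(** [B] may be any set of elements of smaller rank, not only an initial segment; this is where the
    factor [2 ^ #|Q|] in the field size comes from. *)
Definition below B (q : Q) : Prop :=
  forall r, r \in B -> enum_rank r < enum_rank q.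

(* Elements of [Q] are placed in the order of their [enum_rank]: [w q] avoids
   each subspace spanned by some [T i] and earlier vectors, unless that subspace
   contains all of [V q]. *)
Definition generic (I : finType) (T : I -> {vspace L}) (V : Q -> {vspace L}) w :=
  (forall q, w q \in V q) /\
  forall i q B, below B q -> w q \in (T i + span_of w B)%VS ->
    (V q <= T i + span_of w B)%VS.

Lemma eq_span_of w w' B : {in B, w =1 w'} -> span_of w B = span_of w' B.
Proof. by move=> eqw; apply: eq_bigr => q Bq; rewrite eqw. Qed.

Lemma span_ofS w B C : B \subset C -> (span_of w B <= span_of w C)%VS.
Proof.
move=> /subsetP sBC; apply/subv_sumP => q Bq.
exact: (sumv_sup q) (sBC _ Bq) (subvv _).
Qed.

Lemma mem_span_of w B q : q \in B -> w q \in span_of w B.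
Proof. by move=> Bq; rewrite memvE; apply: (sumv_sup q). Qed.

Lemma span_of0 w : span_of w set0 = 0%VS.
Proof. by rewrite /span_of big_set0. Qed.

Lemma span_ofU1 w B q :
  q \notin B -> span_of w (q |: B) = (span_of w B + <[w q]>)%VS.
Proof. by move=> Bq; rewrite /span_of big_setU1 //= addvC. Qed.

Lemma below_notin B q : below B q -> q \notin B.
Proof. by move=> ltBq; apply/negP => /ltBq; rewrite ltnn. Qed.

Lemma span_of_sub w B (U : {vspace L}) :
  (forall q, q \in B -> w q \in U) -> (span_of w B <= U)%VS.
Proof. by move=> Uw; apply/subv_sumP => q Bq; rewrite -memvE Uw. Qed.

Lemma dim_span_of_le w B : \dim (span_of w B) <= #|B|.
Proof.
apply: leq_trans (dimv_leq_sum _ _ _) _; rewrite -sum1_card leq_sum // => q _.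
by rewrite dim_vline leq_b1.
Qed.

(** Peeling off the element of largest rank builds a set in the order in which generic vectors are
    chosen, so that genericity applies at every step. *)
Lemma set_max_ind (F : {set Q} -> Prop) :
  F set0 -> (forall q B, below B q -> F B -> F (q |: B)) -> forall B, F B.
Proof.
move=> F0 FS B; have [m] := ubnP #|B|; elim: m B => // m IHm B ltBm.
have [->|[q0 Bq0]] := set_0Vmem B; first exact: F0.
have [q Bq maxq] := arg_maxnP (fun q => enum_rank q : nat) Bq0.
have {}Bq : q \in B := Bq.
rewrite -(setD1K Bq); apply: FS.
  move=> r; rewrite in_setD1 => /andP[neq Br].
  have := maxq r Br; rewrite /geq /= leq_eqVlt => /predU1P[|//].
  by move/val_inj/enum_rank_inj=> rq; rewrite rq eqxx in neq.
by apply: IHm; rewrite (cardsD1 q) Bq in ltBm.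
Qed.

(** The vectors are chosen in order of rank. Each one has to avoid the subspaces [T i + span_of w B]
    that do not contain its [V q]; there are at most [#|I| * 2 ^ #|Q|] of them. *)
Lemma generic_exists (I : finType) (T : I -> {vspace L}) (V : Q -> {vspace L}) :
  #|I| * 2 ^ #|Q| < #|K| -> exists w, generic T V w.
Proof.
move=> ltK.
suff [w wP] : exists w, forall q, enum_rank q < #|Q| -> w q \in V q /\
    forall i B, below B q -> w q \in (T i + span_of w B)%VS ->
      (V q <= T i + span_of w B)%VS.
  by exists w; split=> [q|i q]; have [] := wP q (ltn_ord _); auto.
suff /(_ #|Q|) : forall k, exists w, forall q, enum_rank q < k -> w q \in V q /\
    forall i B, below B q -> w q \in (T i + span_of w B)%VS ->
      (V q <= T i + span_of w B)%VS by [].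
elim=> [|k [w wP]]; first by exists (fun=> 0%R).
have [ltk | lek] := ltnP k #|Q|; last first.
  by exists w => q _; apply: wP; apply: leq_trans (ltn_ord _) lek.
pose q0 : Q := enum_val (Ordinal ltk).
have rq0 : enum_rank q0 = k :> nat by rewrite enum_valK.
pose N := [pred iB : I * {set Q} | ~~ (V q0 <= T iB.1 + span_of w iB.2)%VS].
have [||v Vv vP] := @exists_notin_subspaces K n {iB | N iB} (V q0)
    (fun x => T (val x).1 + span_of w (val x).2)%VS.
- apply: leq_ltn_trans ltK; rewrite card_sig (leq_trans (max_card _)) //.
  by rewrite card_prod -(cardsT {set Q}) -powersetT card_powerset cardsT.
- by case.
exists (fun q => if q == q0 then v else w q) => q ltqk.
(* A set below an element of rank at most [k] omits [q0], so the new value at [q0] leaves all these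
   spans, and with them the earlier conditions, unchanged. *)
have spE B : below B q ->
    span_of (fun q => if q == q0 then v else w q) B = span_of w B.
  move=> ltB; apply: eq_span_of => r Br; case: eqP => // rE.
  by have := leq_trans (ltB r Br) ltqk; rewrite rE rq0 ltnn.
have [qq0 | neq] := eqVneq q q0.
  split=> [|i B ltB]; first by rewrite qq0.
  rewrite (spE _ ltB) qq0 => wU; apply: contraLR wU => nsub.
  exact: (vP (Sub (i, B) nsub)).
have ltk' : enum_rank q < k.
  rewrite ltn_neqAle -ltnS ltqk andbT; apply: contra neq.
  by rewrite -rq0 => /eqP/val_inj/enum_rank_inj->.
have [Vq wPq] := wP q ltk'; split=> // i B ltB.
by rewrite (spE _ ltB); apply: wPq.
Qed.

(* The dimension is as large as possible until some [V q] is swallowed whole. *)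
Lemma generic_dim (I : finType) (T : I -> {vspace L}) V w i B :
  generic T V w ->
  \dim (T i + span_of w B) = \dim (T i) + #|B| \/
  exists q C, [/\ q \in B, C \subset B :\ q & (V q <= T i + span_of w C)%VS].
Proof.
case=> wV wT; elim/set_max_ind: B => [|q B ltB IH].
  by left; rewrite span_of0 addv0 cards0 addn0.
have Bq := below_notin ltB.
have [/(wT _ _ _ ltB) sV | nwT] := boolP (w q \in (T i + span_of w B)%VS).
  right; exists q, B; split=> //; first exact: setU11.
  by rewrite setU1K.
case: IH => [dimB | [r [C [Br sCB sV]]]].
  by left; rewrite span_ofU1 // addvA dimv_add_line // dimB cardsU1 Bq addnS.
right; exists r, C; split=> //; first by rewrite setU1r.
by apply: subset_trans sCB _; rewrite setSD // subsetUr.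
Qed.

End GenericFamilies.

(** * Subspaces of dimension [a] spanning in pairs, with [w0] in prescribed ones *)

Section Arrangement.

Variables (K : finFieldType) (J : finType) (a b : nat) (S : {set J}).
Notation L := 'rV[K]_(a + b).

Definition arrangement (V : J -> {vspace L}) (w0 : L) : Prop :=
  [/\ w0 != 0%R, forall x, \dim (V x) = a,
      forall x y, x != y -> (V x + V y)%VS = fullv
    & forall x, (w0 \in V x) = (x \in S)].

(** If a set of at most [a + b] vectors were dependent, [generic_dim] would place the whole space in
    the span of strictly fewer vectors. A larger set contains one of size exactly [a + b]. *)
Lemma span_of_generic_full (Q : finType) (w : Q -> L) :
  generic (fun _ : unit => 0%VS) (fun=> fullv) w ->
  (forall B : {set Q}, #|B| <= a + b -> \dim (span_of w B) = #|B|) /\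
  (forall B : {set Q}, a + b <= #|B| -> span_of w B = fullv).
Proof.
move=> gw; have dimf : \dim {: L} = a + b by rewrite dimvf; exact: mul1n.
have free (B : {set Q}) : #|B| <= a + b -> \dim (span_of w B) = #|B|.
  move=> leB; have := generic_dim tt B gw; rewrite !add0v dimv0 add0n.
  case=> // -[q [C [Bq sCB]]]; rewrite add0v => /dimvS; rewrite dimf => leC.
  have := leq_trans leB leC; rewrite (cardsD1 q) Bq add1n.
  by rewrite ltnNge (leq_trans (dim_span_of_le w C) (subset_leq_card sCB)).
split=> // B leB; have [C sCB cC] : exists2 C : {set Q}, C \subset B & #|C| = a + b.
  have := leB; rewrite -bin_gt0 -cards_draws => /card_gt0P [C].
  by rewrite inE => /andP[sC /eqP cC]; exists C.
apply/eqP; rewrite eqEsubv subvf (subv_trans _ (span_ofS w sCB)) //.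
rewrite -(geq_leqif (dimv_leqif_sup (subvf _))).
by rewrite dimf free ?cC.
Qed.

Lemma arrangement_exists :
  0 < b -> b <= a -> (forall x y, x \in S -> y \in S -> x != y -> b < a) ->
  2 ^ #|{: option (J * 'I_a)}| < #|K| ->
  exists V w0, arrangement V w0.
Proof.
move=> b_gt0 leba ltba ltK.
have a_gt0 : 0 < a := leq_trans b_gt0 leba.
have [|w gw] := @generic_exists K (a + b) (option (J * 'I_a)) unit
  (fun=> 0%VS) (fun=> fullv); first by rewrite card_unit mul1n.
have [free full] := span_of_generic_full gw.
(* Each V x is spanned by a generic vectors, and w0, which is generic with
   respect to all of them, replaces one of these when x is in S. *)
pose C x : {set option (J * 'I_a)} := [set Some (x, i) | i in [set: 'I_a]].
pose D x := if x \in S then None |: (C x :\ Some (x, Ordinal a_gt0)) else C x.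
have cardC x : #|C x| = a.
  by rewrite card_imset ?cardsT ?card_ord // => i j [].
have cardD x : #|D x| = a.
  rewrite /D; case: ifP => // _; rewrite cardsU1 in_setD1.
  have -> : None \in C x = false by apply/negbTE/imsetP => -[].
  rewrite andbF add1n.
  have := cardsD1 (Some (x, Ordinal a_gt0)) (C x).
  by rewrite imset_f ?inE // cardC add1n.
have None_D x : (None \in D x) = (x \in S).
  rewrite /D; case: ifP => _; first by rewrite setU11.
  by apply/negbTE/imsetP => -[].
have dimD x : \dim (span_of w (D x)) = a by rewrite free cardD ?leq_addr.
exists (fun x => span_of w (D x)), (w None); split=> // [|x y neq | x].
- have := free [set None]; rewrite cards1 => /(_ (leq_trans b_gt0 (leq_addl _ _))).
  by rewrite /span_of big_set1 dim_vline; case: eqP.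
- have -> : (span_of w (D x) + span_of w (D y))%VS = span_of w (D x :|: D y).
    apply/eqP; rewrite eqEsubv subv_add !span_ofS ?subsetUl ?subsetUr //=.
    apply: span_of_sub => q; rewrite inE => /orP[] /(mem_span_of w).
      by apply/subvP/addvSl.
    by apply/subvP/addvSr.
  (* The index sets [D x] and [D y] share at most [None], and share it only when [x] and [y] both
     lie in [S]. Their union then has [2a - 1] elements, which is at least [a + b] because
     [b < a]. *)
  apply: full; rewrite cardsU !cardD.
  have -> : D x :&: D y = if (x \in S) && (y \in S) then [set None] else set0.
    have DE z q : q \in D z -> q = None \/ exists i, q = Some (z, i).
      have CE r : r \in C z -> exists i, r = Some (z, i).
        by case/imsetP => i _ ->; exists i.
      rewrite /D; case: ifP => _; last by right; apply: CE.
      by rewrite !inE => /orP[/eqP|/andP[_ /CE]]; auto.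
    apply/setP=> q; rewrite inE; apply/andP/idP => [[Dx Dy] | ].
      case: (DE x q Dx) => [qE|[i qE]].
        by move: Dx Dy; rewrite qE !None_D => -> ->; rewrite inE.
      case: (DE y q Dy); rewrite qE // => -[j [xy _]].
      by rewrite xy eqxx in neq.
    case: ifP => [/andP[Sx Sy] | _]; rewrite inE // => /eqP->.
    by rewrite !None_D.
  case: ifP => [/andP[Sx Sy] | _]; last by rewrite cards0 subn0 leq_add2l.
  by rewrite cards1 -addnBA // leq_add2l -ltnS subn1 prednK // (ltba x y).
rewrite -None_D; apply/idP/idP; last exact: mem_span_of.
(* As [0 < b], the [a + 1] vectors indexed by [None |: D x] are still independent, so [w0] cannot
   lie in the span of the others. *)
apply: contraLR => nD; have cU : #|None |: D x| = a.+1 by rewrite cardsU1 nD cardD.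
apply/negP => wD; have : \dim (span_of w (None |: D x)) = a.+1.
  by rewrite free cU // -addn1 leq_add2l.
suff -> : span_of w (None |: D x) = span_of w (D x).
  by rewrite dimD => /eqP; rewrite ltn_eqF.
by rewrite span_ofU1 //; apply/addv_idPl; rewrite -memvE.
Qed.

End Arrangement.

(** * Generic vectors for the participants, and which sets span [w0] *)

Section Realization.

Variables (K : finFieldType) (J P : finType) (a b : nat) (S : {set J}).
Variable blk : P -> J.
Notation L := 'rV[K]_(a + b).
Variables (V : J -> {vspace L}) (w0 : L).
Hypotheses (leba : b <= a) (arrV : arrangement S V w0).
Implicit Types (A B C : {set P}) (x y : J).

Definition block x : {set P} := [set p | blk p == x].

(** Both summands are optional: the boolean switches the line of [w0] on, the option selects at most
    one [V y]. A single finite index type thus covers every subspace against which [w] has to be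
    generic. *)
Definition test_space (t : bool * option J) : {vspace L} :=
  ((if t.1 then <[w0]> else 0) + (if t.2 is Some y then V y else 0))%VS.

Variable w : P -> L.
Hypothesis gw : generic test_space (V \o blk) w.

Let dimV x : \dim (V x) = a. Proof. by case: arrV. Qed.

Let fullVV x y (U : {vspace L}) :
  x != y -> (V x <= U)%VS -> (V y <= U)%VS -> U = fullv.
Proof.
case: arrV => _ _ fullV _ neq sx sy; apply/eqP.
by rewrite eqEsubv subvf -(fullV x y neq) subv_add sx sy.
Qed.

Let memV x : (w0 \in V x) = (x \in S). Proof. by case: arrV. Qed.

Let dimf : \dim {: L} = a + b. Proof. by rewrite dimvf; exact: mul1n. Qed.

Let not_full (U : {vspace L}) : (U != fullv) = (\dim U < a + b).
Proof. by rewrite -(ltn_leqif (dimv_leqif_eq (subvf U))) dimf. Qed.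

Lemma card_block_sum A : #|A| = \sum_x #|A :&: block x|.
Proof.
rewrite -sum1_card (partition_big blk xpredT) //=; apply: eq_bigr => x _.
by rewrite sum1dep_card; apply: eq_card => p; rewrite !inE.
Qed.

Lemma cardD_block A y : #|A :\: block y| = \sum_(x | x != y) #|A :&: block x|.
Proof.
rewrite card_block_sum (bigD1 y) //= [X in X + _](_ : _ = 0).
  apply: eq_bigr => x neq; apply: eq_card => p; rewrite !inE.
  by have [->|] := eqVneq (blk p) x; rewrite ?andbF // neq.
by apply: eq_card0 => p; rewrite !inE; case: eqP; rewrite ?andbF.
Qed.

Lemma span_of_block x A : A \subset block x -> (span_of w A <= V x)%VS.
Proof.
move/subsetP=> sA; apply: span_of_sub => p /sA; rewrite inE => /eqP <-.
by case: gw => + _; apply.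
Qed.

Lemma sub_block_span y A :
  (span_of w A <= V y + span_of w (A :\: block y))%VS.
Proof.
apply: span_of_sub => p Ap; have [py | npy] := boolP (p \in block y).
  apply: subvP (addvSl _ _) _ _; move: py; rewrite inE => /eqP <-.
  by case: gw => + _; apply.
by apply: subvP (addvSr _ _) _ _; rewrite mem_span_of // inE npy.
Qed.

(** Were the dimension smaller, [generic_dim] would put [V x] for some other block [x] into the sum.
    The sum already contains [V y], and two distinct blocks fill the whole space. *)
Lemma dim_test_span e y A :
  \dim (test_space (e, Some y) + span_of w (A :\: block y)) < a + b ->
  \dim (test_space (e, Some y) + span_of w (A :\: block y)) =
    \dim (test_space (e, Some y)) + #|A :\: block y|.
Proof.
rewrite -not_full => nfull.
have [//|[p [C [+ sC sV]]]] := generic_dim (e, Some y) (A :\: block y) gw.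
rewrite inE => /andP[npy Ap]; case/negP: nfull; apply/eqP.
apply: (@fullVV (blk p) y); first by apply: contra npy; rewrite inE.
  apply: subv_trans sV _; apply: addvS (subvv _) (span_ofS w _).
  exact: subset_trans sC (subsetDl _ _).
by rewrite /test_space /=; apply: subv_trans (addvSl _ _); exact: addvSr.
Qed.

Lemma test_space_0 o :
  test_space (false, o) = (if o is Some y then V y else 0)%VS.
Proof. by rewrite /test_space add0v. Qed.

Lemma minn_sum_le A y :
  \sum_x minn #|A :&: block x| a <= a + #|A :\: block y|.
Proof.
rewrite (bigD1 y) //= leq_add ?geq_minr // cardD_block leq_sum // => x _.
exact: geq_minl.
Qed.

Lemma mem_span_of_block A x : x \in S -> a <= #|A :&: block x| -> w0 \in span_of w A.
Proof.
move=> Sx; rewrite -bin_gt0 -cards_draws => /card_gt0P [C].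
rewrite inE subsetI => /andP[/andP[sCA sCx] /eqP cC].
apply: subvP (span_ofS w sCA) _ _.
suff -> : span_of w C = V x by rewrite memV.
have sV := span_of_block sCx; apply/eqP; rewrite eqEsubv sV /=.
(* Either the [a] chosen vectors are independent and span [V x] by dimension, or the span of some of
   them already contains [V x]. *)
have := generic_dim (false, None) C gw; rewrite test_space_0 dimv0 add0v cC.
case=> [dC | [q [B [Cq sB]]]].
  by rewrite -(geq_leqif (dimv_leqif_sup sV)) dC dimV.
rewrite add0v /=; have := subsetP sCx _ Cq; rewrite inE => /eqP -> sVB.
apply: subv_trans sVB (span_ofS w _); exact: subset_trans sB (subsetDl _ _).
Qed.

Lemma span_of_full A : a + b <= \sum_x minn #|A :&: block x| a -> span_of w A = fullv.
Proof.
move=> leA; apply/eqP; apply/negPn/negP => nfull.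
have nf := nfull; rewrite not_full in nf.
have := generic_dim (false, None) A gw; rewrite test_space_0 dimv0 add0v.
(* Independence would give dimension [#|A|], at least [a + b]. Otherwise some [V y] is swallowed,
   and [V y] with the vectors outside block [y] has dimension [a + #|A :\: block y|], again at least
   [a + b]. *)
case=> [dA | [q [B [Aq sB]]]].
  move: nf; rewrite dA ltnNge (leq_trans leA) // card_block_sum leq_sum // => x _.
  exact: geq_minl.
rewrite add0v /=; set y := blk q => sVB.
have sVA : (V y <= span_of w A)%VS.
  by apply: subv_trans sVB (span_ofS w _); exact: subset_trans sB (subsetDl _ _).
have sU : (test_space (false, Some y) + span_of w (A :\: block y) <= span_of w A)%VS.
  by rewrite test_space_0 subv_add sVA span_ofS ?subsetDl.
have ltU := leq_ltn_trans (dimvS sU) nf.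
have dU := dim_test_span ltU.
by move: ltU; rewrite dU test_space_0 dimV ltnNge (leq_trans leA) ?minn_sum_le.
Qed.

Lemma dim_line_add y : y \notin S -> \dim (test_space (true, Some y)) = a.+1.
Proof. by move=> nSy; rewrite /test_space addvC dimv_add_line ?memV ?dimV. Qed.

Lemma notin_span_of A :
  (forall x, x \in S -> #|A :&: block x| < a) ->
  \sum_x minn #|A :&: block x| a < a + b -> w0 \notin span_of w A.
Proof.
move=> ltS ltA; apply/negP => w0A.
(* First case: block [y] contributes [a] to the sum, so the others contribute less than [b]. As
   [b <= a], none of these exceeds [a], so [minn] returns their true sizes. Adding [w0] to [V y]
   must then raise the dimension, which contradicts [w0A]. *)
case: (pickP (fun y => a <= #|A :&: block y|)) => [y ley | small].
  have nSy : y \notin S by apply: contraL ley => /ltS; rewrite ltnNge.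
  have ltB : #|A :\: block y| < b.
    move: ltA; rewrite (bigD1 y) //= (minn_idPr ley) ltn_add2l => ltA.
    rewrite cardD_block (leq_ltn_trans _ ltA) // leq_sum // => x neq.
    rewrite leq_min leqnn /= leqNgt; apply/negP => lta.
    move: ltA; rewrite (bigD1 x) //= ltnNge => /negP; apply.
    by rewrite (leq_trans leba) // (leq_trans _ (leq_addr _ _)) // leq_min leqnn ltnW.
  have sU : (test_space (true, Some y) + span_of w (A :\: block y) <=
             V y + span_of w (A :\: block y))%VS.
    rewrite /test_space /= subv_add addvSr andbT subv_add addvSl andbT -memvE.
    exact: subvP (sub_block_span y A) _ w0A.
  have leU := dimvS sU.
  have leV : \dim (V y + span_of w (A :\: block y)) <= a + #|A :\: block y|.
    apply: leq_trans (dimv_add_leqif _ _) _.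
    by rewrite dimV leq_add2l dim_span_of_le.
  have := @dim_test_span true y A.
  rewrite (leq_ltn_trans (leq_trans leU leV)) ?ltn_add2l // => /(_ isT) dU.
  by have := leq_trans leU leV; rewrite dU dim_line_add // addSn ltnn.
(* Second case: every block has fewer than [a] participants in [A], so the sum is [#|A|] itself.
   Adding the line of [w0] must raise the dimension unless it helps to swallow some [V y]. *)
have cA : #|A| < a + b.
  rewrite card_block_sum (leq_ltn_trans _ ltA) // leq_sum // => x _.
  by rewrite leq_min leqnn ltnW // ltnNge small.
have sA : (test_space (true, None) + span_of w A <= span_of w A)%VS.
  by rewrite /test_space addv0 subv_add subvv andbT -memvE.
have w0n0 : w0 != 0%R by case: arrV.
have dT : \dim (test_space (true, None)) = 1.
  by rewrite /test_space addv0 dim_vline w0n0.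
case: (generic_dim (true, None) A gw) => [dA | [p [C [Ap sC]]]].
  have := leq_trans (dimvS sA) (dim_span_of_le w A).
  by rewrite dA dT add1n ltnn.
rewrite /=; set y := blk p; set U := (_ + _)%VS => sVU.
have leU : \dim U <= #|C|.+1.
  apply: leq_trans (dimv_add_leqif _ _) _.
  by rewrite dT add1n ltnS dim_span_of_le.
have ltCA : #|C| < #|A|.
  by rewrite (cardsD1 p A) Ap add1n ltnS subset_leq_card.
have sU : (test_space (true, Some y) + span_of w (C :\: block y) <= U)%VS.
  rewrite subv_add; apply/andP; split; last first.
    by apply: subv_trans (addvSr _ _); rewrite span_ofS ?subsetDl.
  rewrite /test_space /= subv_add sVU andbT.
  by apply: subv_trans (addvSl _ _); rewrite /test_space addv0.
have ltU := leq_ltn_trans (leq_trans (dimvS sU) leU) (leq_ltn_trans ltCA cA).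
have dU := dim_test_span ltU.
have leaT : a <= \dim (test_space (true, Some y)).
  by apply: leq_trans (dimvS (addvSr _ (V y))); rewrite dimV.
have := leq_trans (dimvS sU) leU; rewrite dU.
rewrite -(cardsID (block y) C) -addSn leq_add2r => /(leq_trans leaT).
(* Comparing dimensions leaves [a <= #|C :&: block y| + 1]. The extra 1 is paid for by [p], which
   lies in [A :&: block y] but not in [C]; so block [y] would have [a] participants in [A]. *)
move=> lea; have /negP := negbT (small y); apply; apply: leq_trans lea _.
rewrite (cardsD1 p (A :&: block y)) !inE Ap eqxx add1n ltnS subset_leq_card //.
apply/subsetP=> q; rewrite !inE => /andP[Cq ->].
by have := subsetP sC q Cq; rewrite !inE => /andP[-> ->].
Qed.

End Realization.

(** * Probabilities under the uniform law as counts *)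

Section UniformLaw.

Variables (R : realType) (Omega : finType).
Hypothesis Omega_gt0 : 0 < #|Omega|.

Definition uniform_mass (_ : Omega) : R := (#|Omega|%:R^-1)%R.

Let cardR : (#|Omega|%:R != 0 :> R)%R.
Proof. by rewrite pnatr_eq0 -lt0n. Qed.

Lemma prob_uniform E : (prob uniform_mass E = #|E|%:R / #|Omega|%:R)%R.
Proof. by rewrite /prob sumr_const -[LHS]mulr_natl. Qed.

Lemma uniform_mass_distribution : is_distribution uniform_mass.
Proof.
split=> [f|]; first by rewrite invr_ge0 ler0n.
by rewrite sumr_const -[LHS]mulr_natl mulfV.
Qed.

Lemma uniform_full_range (U : finType) (X : Omega -> U) :
  (forall u, exists f, X f = u) -> full_range uniform_mass X.
Proof.
move=> surj u; rewrite prob_uniform divr_gt0 ?ltr0n //.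
by have [f Xf] := surj u; apply/card_gt0P; exists f; rewrite inE Xf.
Qed.

Lemma uniform_independent (U V : finType) (X : Omega -> U) (Y : Omega -> V) :
  (forall u v, #|[set f | (X f == u) && (Y f == v)]| * #|Omega| =
     #|[set f | X f == u]| * #|[set f | Y f == v]|) ->
  independent uniform_mass X Y.
Proof.
move=> indep u v; rewrite !prob_uniform mulrACA -natrM -indep natrM -!mulrA.
by congr (_ * _)%R; rewrite mulrA mulfV // mul1r.
Qed.

Lemma uniform_determines (U V : finType) (X : Omega -> U) (Y : Omega -> V) F :
  (forall f, Y f = F (X f)) -> determines uniform_mass X Y.
Proof.
move=> YE; exists F; rewrite prob_uniform (_ : [set _ | _] = setT) ?cardsT ?mulfV //.
by apply/setP=> f; rewrite !inE YE eqxx.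
Qed.

End UniformLaw.

(** * The ideal scheme given by a random linear form *)

Section LinearScheme.

Variables (K : finFieldType) (n : nat) (P : finType).
Variables (w : P -> 'rV[K]_n) (w0 : 'rV[K]_n).
Implicit Types (A : {set P}) (f : 'cV[K]_n) (v : 'rV[K]_n).

Definition pairing v f : K := (v *m f)%R ord0 ord0.

Lemma pairingD v f f' : pairing v (f + f')%R = (pairing v f + pairing v f')%R.
Proof. by rewrite /pairing mulmxDr mxE. Qed.

Lemma pairingZ v c f : pairing v (c *: f)%R = (c * pairing v f)%R.
Proof. by rewrite /pairing -scalemxAr mxE. Qed.

(** The columns of [cokermx W] are forms vanishing on the rows of [W]; one of them is nonzero at
    [v], and is rescaled to take the value 1 there. *)
Lemma submx_separation m (W : 'M[K]_(m, n)) v : ~~ (v <= W)%MS ->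
  exists2 f, pairing v f = 1%R & forall i, pairing (row i W) f = 0%R.
Proof.
rewrite submxE => /rV0Pn [j nz]; pose f0 := col j (cokermx W).
have colE u : pairing u f0 = (u *m cokermx W)%R ord0 j.
  by rewrite /pairing /f0 !mxE; apply: eq_bigr => i _; rewrite !mxE.
exists ((pairing v f0)^-1 *: f0)%R; first by rewrite pairingZ mulVf ?colE.
by move=> i; rewrite pairingZ (colE (row i W)) -row_mul mulmx_coker row0 mxE mulr0.
Qed.

Lemma separating_functional A v : v \notin span_of w A ->
  exists2 f, pairing v f = 1%R & forall p, p \in A -> pairing (w p) f = 0%R.
Proof.
(* Rows of participants outside [A] are set to 0, which keeps the row space inside [span_of w A]. *)
move=> nAv; pose W : 'M[K]_(#|P|, n) :=
  (\matrix_(i < #|P|) (if enum_val i \in A then w (enum_val i) else 0))%R.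
have /submx_separation [f vf Wf] : ~~ (v <= W)%MS.
  apply: contra nAv => /submxP [c ->]; rewrite mulmx_sum_row.
  rewrite rpred_sum // => i _; rewrite rpredZ // rowK.
  by case: ifP => [Ai | _]; rewrite ?mem0v ?mem_span_of.
by exists f => // p Ap; have := Wf (enum_rank p); rewrite rowK enum_rankK Ap.
Qed.

(** Translation by multiples of [f0] preserves [E] and carries any fibre of [pairing v] onto any
    other, so all [#|K|] fibres have the same size. *)
Lemma card_fiber (v : 'rV[K]_n) f0 (E : {set 'cV[K]_n}) : pairing v f0 = 1%R ->
  (forall c f, f \in E -> (f + c *: f0)%R \in E) ->
  forall b, #|E| = #|K| * #|[set f in E | pairing v f == b]|.
Proof.
move=> vf0 EE b; rewrite -sum1_card (partition_big (pairing v) xpredT) //=.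
rewrite -sum_nat_const; apply: eq_bigr => c _; rewrite sum1dep_card.
have inj : injective (fun f => f + (b - c) *: f0)%R := addIr _.
rewrite -(card_imset _ inj); apply: eq_card => f; rewrite !inE.
apply/imsetP/andP => [[f' + ->] | [Ef /eqP vf]].
  rewrite inE => /andP[Ef' /eqP vf']; split; first exact: EE.
  by rewrite pairingD pairingZ vf0 vf' mulr1 addrC subrK.
exists (f + (c - b) *: f0)%R; last first.
  by rewrite -addrA -scalerDl -opprB addNr scale0r addr0.
by rewrite inE EE // pairingD pairingZ vf0 vf mulr1 addrC subrK eqxx.
Qed.

Lemma pairing_surj v : v != 0%R -> forall c, exists f, pairing v f = c.
Proof.
move=> v0 c; have [|f vf _] := @separating_functional set0 v.
  by rewrite span_of0 memv0.
by exists (c *: f)%R; rewrite pairingZ vf mulr1.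
Qed.

Lemma mem_span_ofP A v : v \in span_of w A ->
  exists c : P -> K, (v = \sum_(p in A) c p *: w p)%R.
Proof.
case/memv_sumP=> u uw ->.
have /fin_all_exists [c cP] p : exists c : K, p \in A -> (u p = c *: w p)%R.
  have [Ap | nAp] := boolP (p \in A); last by exists 0%R.
  by have /vlineP [c uE] := uw p Ap; exists c.
by exists c; apply: eq_bigr => p /cP.
Qed.

Lemma linear_scheme_ideal (R : realType) (Gamma : {set P} -> Prop) :
  w0 != 0%R -> (forall p, w p != 0%R) ->
  (forall A, Gamma A <-> w0 \in span_of w A) ->
  ideal_access_structure R Gamma.
Proof.
move=> w0n0 wn0 GammaP.
have Omega_gt0 : 0 < #|'cV[K]_n| by apply/card_gt0P; exists 0%R.
pose share p f : K := pairing (w p) f.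
have correct A : Gamma A ->
    determines (@uniform_mass R 'cV[K]_n) (joint_share share A) (pairing w0).
  move/GammaP/mem_span_ofP => [c w0E].
  (* The secret is recovered from the shares by the coefficients that express [w0] through the
     vectors of [A]. *)
  apply: (@uniform_determines _ _ _ _ _ _ _
    (fun t : share_tuple (fun=> K) A => \sum_p c (val p) * t p)%R) => // f.
  rewrite {1}/pairing w0E mulmx_suml summxE big_sub; apply: eq_bigr => p _.
  by rewrite ffunE -scalemxAl mxE.
have private A : ~ Gamma A ->
    independent (@uniform_mass R 'cV[K]_n) (joint_share share A) (pairing w0).
  move=> nGA; have nspan : w0 \notin span_of w A by apply/negP => /GammaP.
  (* Adding multiples of [f0] fixes all shares of [A] while the secret runs through [K].
     [card_fiber], applied to the forms with given shares and to all forms, yields the same factor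
     [#|K|] twice, whence independence. *)
  have [f0 f01 f0A] := separating_functional nspan.
  apply: uniform_independent => // t c.
  set E := [set f | joint_share share A f == t].
  rewrite (_ : [set f | _ && _] = [set f in E | pairing w0 f == c]); last first.
    by apply/setP=> f; rewrite !inE.
  rewrite (@card_fiber w0 f0 E f01 _ c); last first.
    move=> c' f; rewrite !inE => /eqP <-; apply/eqP/ffunP => p; rewrite !ffunE.
    by rewrite /share pairingD pairingZ f0A ?mulr0 ?addr0 // (valP p).
  rewrite -cardsT (@card_fiber w0 f0 setT f01 _ c); last by move=> *; rewrite inE.
  rewrite mulnCA mulnA; congr (_ * #|pred_of_set _|).
  by apply/setP=> f; rewrite !inE.
have distr := @uniform_mass_distribution R _ Omega_gt0.
have range v : v != 0%R -> full_range (@uniform_mass R 'cV[K]_n) (pairing v).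
  by move=> vn0; apply: uniform_full_range => // u; apply: pairing_surj.
by exists (@PerfectScheme R P Gamma 'cV[K]_n (@uniform_mass R _) K (fun=> K)
  (pairing w0) share distr (finNzRing_gt1 K) (range _ w0n0)
  (fun p => range _ (wn0 p)) correct private).
Qed.

End LinearScheme.

(** * Polymatroids with [g 2 = 0] and their authorized sets *)

Lemma exists_subvector (J : finType) (u : J -> nat) (m : nat) :
  m <= \sum_x u x ->
  exists2 v : {ffun J -> nat}, (forall x, v x <= u x) & \sum_x v x = m.
Proof.
elim: m => [|m IHm] lem.
  by exists [ffun=> 0] => [x|]; rewrite ?ffunE // big1 // => x _; rewrite ffunE.
have [v vu vm] := IHm (ltnW lem).
have [x ltx] : exists x, v x < u x.
  apply/existsP; apply: contraLR lem => /existsPn nlt.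
  by rewrite -leqNgt -vm leq_sum // => x _; rewrite leqNgt.
exists [ffun y => v y + (y == x)] => [y|].
  by rewrite ffunE; case: eqP => [->|_]; rewrite ?addn1 ?addn0.
under eq_bigr do rewrite ffunE.
rewrite big_split /= vm (bigD1 x) //= eqxx big1 ?addn1 // => y neq.
by rewrite (negPf neq).
Qed.

Section TwoIncrements.

Variables (J : finType) (h : {set J} -> nat) (g : nat -> nat).
Hypotheses (J_gt1 : 2 <= #|J|) (hg : uniform_polymatroid h g) (g2 : g 2 = 0).

Implicit Types X Y : {set J}.

Let h0 : h set0 = 0. Proof. by case: hg => -[]. Qed.
Let h_mono X Y : X \subset Y -> h X <= h Y.
Proof. by case: hg => -[_ + _] _ _ _; apply. Qed.

Let hU1 X x : x \notin X -> h (x |: X) = h X + g #|X|.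
Proof.
move=> Xx; case: hg => _ _ [gE _] _; rewrite (gE X (x |: X)) ?cardsU1 ?Xx //.
by rewrite subnKC // h_mono // subsetUr.
Qed.

Lemma polymatroid_set1 x : h [set x] = g 0.
Proof. by rewrite -(setU0 [set x]) hU1 ?inE // h0 cards0. Qed.

Lemma polymatroid_set2 x y : x != y -> h [set x; y] = g 0 + g 1.
Proof. by move=> neq; rewrite hU1 ?inE // polymatroid_set1 cards1. Qed.

(** By submodularity, adding [z] to a set containing the pair [x], [y] gains no more than adding it
    to the pair alone, that is, at most [g 2 = 0]. *)
Lemma polymatroid_ge2 X : 2 <= #|X| -> h X = g 0 + g 1.
Proof.
case/card_gt1P => x [y [Xx Xy neq]].
suff hE Y : h ([set x; y] :|: Y) = h [set x; y].
  by rewrite -(polymatroid_set2 neq) -(hE X) (setUidPr _) // subUset !sub1set Xx.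
have [m] := ubnP #|Y|; elim: m Y => // m IHm Y ltY.
have [->|[z Yz]] := set_0Vmem Y; first by rewrite setU0.
rewrite -(setD1K Yz) setUCA; set Z := Y :\ z.
have {}IHm : h ([set x; y] :|: Z) = h [set x; y].
  by apply: IHm; rewrite (cardsD1 z) Yz in ltY.
have [zZ | nzZ] := boolP (z \in [set x; y] :|: Z).
  by rewrite (setUidPr _) ?sub1set.
have nzxy : z \notin [set x; y] by apply: contra nzZ => zxy; rewrite inE zxy.
apply/eqP; rewrite eqn_leq; apply/andP; split; last first.
  by apply/h_mono/(subset_trans (subsetUl _ Z))/subsetUr.
have [[_ _ sub] _ _ _] := hg.
have := sub (z |: [set x; y]) ([set x; y] :|: Z).
rewrite (hU1 nzxy) cards2 neq g2 addn0 IHm.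
rewrite -(setUA [set z]) (setUidPr (subsetUl _ Z)).
have le : h [set x; y] <= h ((z |: [set x; y]) :&: ([set x; y] :|: Z)).
  by rewrite h_mono // subsetI subsetUr subsetUl.
by move/(leq_trans _); rewrite -(leq_add2l (h [set x; y])); apply; rewrite leq_add2r.
Qed.

Variables (P : finType) (Pi : J -> {set P}) (Delta : {set {set J}}).
Hypothesis Delta_mono : monotone_family Delta.

(** Submodularity of the extension at [{x0, x}] and [{x0, y}] reads [1 + (g 0 + g 1) <= g 0 + g 0];
    the 1 is the value at [{x0}], since the empty set is not in [Delta]. *)
Lemma compatible_singletons x y : compatible h Delta ->
  [set x] \in Delta -> [set y] \in Delta -> x != y -> g 1 < g 0.
Proof.
case=> _ sub Dx Dy neq; have [_ D0 Dup] := Delta_mono.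
have := sub [set None; Some x] [set None; Some y]; rewrite /extension !inE /=.
have trace z : [set t | Some t \in [set None; Some z]] = [set z].
  by apply/setP=> t; rewrite !inE.
have -> : [set t | Some t \in [set None; Some x] :&: [set None; Some y]] = set0.
  apply/setP=> t; rewrite !inE /=; apply/negP=> /andP[/eqP[->] /eqP[xy]].
  by rewrite xy eqxx in neq.
have -> : [set t | Some t \in [set None; Some x] :|: [set None; Some y]] = [set x; y].
  by apply/setP=> t; rewrite !inE.
have Dxy : [set x; y] \in Delta by apply: Dup Dx _; rewrite subsetUl.
rewrite !trace Dx Dy D0 Dxy /= h0 !polymatroid_set1 polymatroid_set2 //.
by rewrite add1n -addnS leq_add2l.
Qed.

(** As [h] is [g 0] on singletons and [g 0 + g 1] on all larger sets, a basis vector is constrained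
    only by the bound [g 0] on its coordinates and by its total weight. *)
Lemma access_structureP A :
  access_structure Pi h Delta A <->
  (exists2 x, [set x] \in Delta & g 0 <= #|A :&: Pi x|) \/
  g 0 + g 1 <= \sum_x minn #|A :&: Pi x| (g 0).
Proof.
have [Dn0 D0 Dup] := Delta_mono; split.
  case=> X [v [DX [/subsetP supv hv vY] vA]].
  have le_v x : v x <= minn #|A :&: Pi x| (g 0).
    have := vA x; rewrite ffunE leq_min => -> /=.
    have [Xx | nXx] := boolP (x \in X).
      have := vY [set x]; rewrite sub1set => /(_ Xx).
      by rewrite /weight big_set1 polymatroid_set1.
    have : x \notin supp v by apply: contra nXx => /supv.
    by rewrite inE negbK => /eqP->.
  have sumv : \sum_x v x = h X by rewrite -hv /weight; apply: eq_bigl => x; rewrite inE.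
  have [ge2 | ] := leqP 2 #|X|.
    by right; rewrite -(polymatroid_ge2 ge2) -sumv leq_sum.
  rewrite ltnS leq_eqVlt ltnS leqn0 cards_eq0 orbC.
  case/orP=> [/eqP XE | /cards1P [x XE]]; first by rewrite -XE DX in D0.
  left; exists x; first by rewrite -XE.
  rewrite -(polymatroid_set1 x) -XE -sumv (bigD1 x) //= big1 ?addn0.
    exact: leq_trans (le_v x) (geq_minl _ _).
  move=> y neq; have : y \notin supp v.
    by apply/negP => /supv; rewrite XE inE (negPf neq).
  by rewrite inE negbK => /eqP.
have weightT (v : {ffun J -> nat}) : weight v [set: J] = \sum_x v x.
  by rewrite /weight; apply: eq_bigl => x; rewrite inE.
case=> [[x Dx lex] | leA].
  exists [set x], [ffun y => (y == x) * g 0]; split=> //.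
    split.
    - apply/subsetP=> y; rewrite !inE ffunE.
      by case: (y == x).
    - rewrite weightT (bigD1 x) //= ffunE eqxx mul1n big1 ?addn0 ?polymatroid_set1 //.
      by move=> y /negPf neq; rewrite ffunE neq.
    - move=> Y; rewrite subset1 => /orP[] /eqP->.
        by rewrite /weight big_set1 ffunE eqxx mul1n polymatroid_set1.
      by rewrite /weight big_set0.
  by move=> y; rewrite !ffunE; case: eqP => [->|]; rewrite ?mul1n ?mul0n.
have [v vu vm] := exists_subvector leA.
have /set0Pn [X DX] := Dn0.
(* The full set [J] lies in [Delta], a nonempty family closed under supersets, and has rank
   [g 0 + g 1], the total weight of [v]. *)
exists setT, v; split.
- exact: Dup DX (subsetT _).
- split; first exact: subsetT.
    by rewrite weightT vm polymatroid_ge2 // cardsT.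
  move=> Y _; have [ge2 | ] := leqP 2 #|Y|.
    by rewrite polymatroid_ge2 // -vm /weight big_mkcond leq_sum // => x _; case: ifP.
  rewrite ltnS leq_eqVlt ltnS leqn0 cards_eq0 orbC.
  case/orP=> [/eqP-> | /cards1P [x ->]]; first by rewrite /weight big_set0.
  by rewrite /weight big_set1 polymatroid_set1; apply: leq_trans (vu x) (geq_minr _ _).
- by move=> x; rewrite ffunE; apply: leq_trans (vu x) (geq_minl _ _).
Qed.

End TwoIncrements.

(** * Choice of the field and assembly of the scheme *)

Theorem theorem5p1 (R : realType) (J : finType) (h : {set J} -> nat)
    (g : nat -> nat) :
  2 <= #|J| ->
  uniform_polymatroid h g ->
  g 1 <= g 0 -> 0 < g 1 -> g 2 = 0 ->
  forall (P : finType) (Pi : J -> {set P}) (Delta : {set {set J}}),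
    participant_partition Pi ->
    (forall x : J, g 0 < #|Pi x|) ->
    monotone_family Delta ->
    compatible h Delta ->
    ideal_access_structure R (access_structure Pi h Delta).
Proof.
move=> J_gt1 hg leg g1_gt0 g2 P Pi Delta [_ Pidisj Picover] _ Dmono Dcomp.
pose a := g 0; pose b := g 1; pose S := [set x | [set x] \in Delta].
have a_gt0 : 0 < a := leq_trans g1_gt0 leg.
have /fin_all_exists [blk blkP] p : exists x, p \in Pi x.
  by have /bigcupP[x _] : p \in \bigcup_x Pi x; [rewrite Picover inE | exists x].
have PiE x : Pi x = block blk x.
  apply/setP=> p; rewrite inE; apply/idP/eqP => [px | <- //].
  apply/eqP; apply: contraTT px => /Pidisj /pred0P /(_ p) /=.
  by rewrite blkP /= => ->.
(* The first summand is the field size needed for the arrangement, the second the one needed to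
   choose the participants' vectors. *)
have [q ltq q_prime] := prime_above
  (2 ^ #|{: option (J * 'I_a)}| + #|{: bool * option J}| * 2 ^ #|P|).
have [ltq1 ltq2] : 2 ^ #|{: option (J * 'I_a)}| < #|'F_q| /\
    #|{: bool * option J}| * 2 ^ #|P| < #|'F_q|.
  by rewrite card_Fp //; split; apply: leq_ltn_trans ltq; rewrite ?leq_addr ?leq_addl.
have [|V [w0 arrV]] := @arrangement_exists 'F_q J a b S g1_gt0 leg _ ltq1.
  by move=> x y; rewrite !inE; apply: (compatible_singletons hg Dmono Dcomp).
have [w gw] := @generic_exists 'F_q (a + b) P _ (test_space V w0) (V \o blk) ltq2.
have [w0n0 dimV _ _] := arrV.
apply: (@linear_scheme_ideal _ _ _ w w0) => // [p | A].
  (* Genericity against the zero space gives [w p != 0]: otherwise [V (blk p)], of dimension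
     [a > 0], would be contained in 0. *)
  have [_ /(_ (false, None) p set0)] := gw; rewrite span_of0 /test_space !addv0.
  move=> wp; apply/eqP => wp0; have /wp : below set0 p by move=> r; rewrite inE.
  rewrite wp0 mem0v => /(_ isT) /dimvS; rewrite dimv0 /= dimV leqNgt.
  by rewrite a_gt0.
rewrite (access_structureP J_gt1 hg g2 Pi Dmono); split.
  case=> [[x Dx lex] | leA].
    by apply: (mem_span_of_block arrV gw (x := x)); rewrite ?inE -?PiE.
  rewrite (span_of_full arrV gw) ?memvf //.
  by under eq_bigr do rewrite -PiE.
move=> w0A; have [|ltA] := leqP (a + b) (\sum_x minn #|A :&: Pi x| a).
  by right.
case: (pickP [pred x | ([set x] \in Delta) && (a <= #|A :&: Pi x|)]) => [x | small].
  by case/andP; left; exists x.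
have eqA : \sum_x minn #|A :&: block blk x| a < a + b by under eq_bigr do rewrite -PiE.
suff /negP : w0 \notin span_of w A by [].
apply: (notin_span_of leg arrV gw) eqA => x; rewrite inE -PiE => Dx.
by have := small x; rewrite /= Dx /= ltnNge => ->.
Qed.
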